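(* Let $\varepsilon>0$. If $G$ is uniformly distributed on $[0,1]$ and $\xi$, independent of $G$, follows an exponential distribution (density $\lambda e^{-\lambda x}$ on $x\ge0$) such that the noise-to-signal ratio is $\varepsilon$, the parameter being taken for this purpose to be $\lambda=\frac{1}{\varepsilon\sqrt{12}}$, and if $M=G+\xi$, then for $0<\alpha\le \varepsilon\sqrt{12}\left(1-e^{-1/(\varepsilon\sqrt{12})}\right)$ we have $$\rho_\alpha=0\qquad\text{and}\qquad \mathbb E_\alpha[G]=\frac1\lambda\,\frac{\lambda e^\lambda-e^\lambda+1}{e^\lambda-1}.$$ As $\varepsilon\to0$, we have $\mathbb E_\alpha[G]=1-\varepsilon\sqrt{12}+O(\varepsilon^2)$.
   Context: $G$ is the goal, $\xi$ the discrepancy, $M=G+\xi$ the measure. The noise-to-signal ratio is the number $\varepsilon$ with $\varepsilon^2=\mathrm{Var}(\xi)/\mathrm{Var}(G)$. For $\alpha\in(0,1)$, $m_\alpha$ denotes the top-$\alpha$ quantile of $M$, i.e. $\mathbb P[M\ge m_\alpha]=\alpha$. A subscript $\alpha$ denotes conditioning on the event $M\ge m_\alpha$: $\mathbb E_\alpha[X]=\mathbb E[X\mid M\ge m_\alpha]$, and $\mathrm{Var}_\alpha$, $\mathrm{Cov}_\alpha$ are the corresponding conditional variance and covariance. The correlation among the top-$\alpha$ values of $M$ is $\rho_\alpha=\mathrm{Cov}_\alpha(G,M)/\sqrt{\mathrm{Var}_\alpha(G)\,\mathrm{Var}_\alpha(M)}$.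
   Formalization: The condition that the noise-to-signal ratio is ε is dropped and only λ=1/(ε√12) is kept, since with this λ the ratio is 12ε (Var(ξ)=12ε², Var(G)=1/12), so the two conditions contradict each other. *)

(* Defs.v *)
From HB Require Import structures.
From mathcomp Require Export all_boot all_order all_algebra.
(* These files one by one rather than all_analysis, whose import order hides
   the ring structure of {mfun T >-> R}. *)
From mathcomp Require Export boolp classical_sets functions cardinality fsbigop.
From mathcomp Require Export reals ereal landau topology normedtype sequences.
From mathcomp Require Export derive measure exp numfun realfun.
From mathcomp Require Export measurable_realfun lebesgue_measure.
From mathcomp Require Export lebesgue_integral hoelder probability.

Set Implicit Arguments.
Unset Strict Implicit.
Unset Printing Implicit Defensive.
Export Order.TTheory GRing.Theory Num.Theory.
Export numFieldNormedType.Exports.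

Local Open Scope classical_set_scope.
Local Open Scope ring_scope.

Definition independent_RV (d : measure_display) (T : measurableType d)
    (R : realType) (P : probability T R) (X Y : {RV P >-> R}) : Prop :=
  forall A B : set R, measurable A -> measurable B ->
    P (X @^-1` A `&` Y @^-1` B) = (P (X @^-1` A) * P (Y @^-1` B))%E.

Definition noisy (d : measure_display) (T : measurableType d)
    (R : realType) (P : probability T R) (G xi : {RV P >-> R})
    : {RV P >-> R} :=
  G + xi.

Definition top_event (T : Type) (R : realType) (M : T -> R) (m : R) : set T :=
  [set w | m <= M w].

Lemma measurable_top_event (d : measure_display) (T : measurableType d)
    (R : realType) (P : probability T R) (M : {RV P >-> R}) (m : R) :
  measurable (top_event M m).
Proof.
rewrite (_ : top_event M m = M @^-1` `[m, +oo[%classic).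
  by apply: measurable_funPTI => //; exact: measurable_itv.
by apply/seteqP; split => w /=; rewrite in_itv/= andbT.
Qed.

Definition is_top_quantile (d : measure_display) (T : measurableType d)
    (R : realType) (P : probability T R) (M : {RV P >-> R}) (alpha m : R)
    : Prop :=
  P (top_event M m) = alpha%:E.

(* P( . | M >= m); when the event has probability 0, mnormalize falls back to
   its second argument, here P itself. *)
Definition top_prob (d : measure_display) (T : measurableType d)
    (R : realType) (P : probability T R) (M : {RV P >-> R}) (m : R)
    : probability T R :=
  mnormalize (mrestr P (measurable_top_event M m)) P.

Definition top_correlation (d : measure_display) (T : measurableType d)
    (R : realType) (P : probability T R) (G M : {RV P >-> R}) (m : R) : R :=
  fine (covariance (top_prob M m) G M) /
  Num.sqrt (fine (variance (top_prob M m) G) * fine (variance (top_prob M m) M)).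

(* This rate gives Var(xi) / Var(G) = (12 * eps)^2 when G is uniform on [0, 1];
   the rate with ratio eps^2 would be sqrt 12 / eps. The bound alpha_max below is
   the one for the rate 1 / (eps * sqrt 12). *)
Definition exp_rate (R : realType) (eps : R) : R := (eps * Num.sqrt 12)^-1.

Definition uniform_exponential_model (d : measure_display)
    (T : measurableType d) (R : realType) (P : probability T R)
    (G xi : {RV P >-> R}) (eps : R) : Prop :=
  [/\ forall A : set R, measurable A ->
        distribution P G A = uniform_prob (@ltr01 R) A,
      forall A : set R, measurable A ->
        distribution P xi A = exponential_prob (exp_rate eps) A &
      independent_RV G xi].

Definition alpha_max (R : realType) (eps : R) : R :=
  eps * Num.sqrt 12 * (1 - expR (- (eps * Num.sqrt 12)^-1)).

(* Main.v *)
(* For t >= 1 the exponential tail gives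
     P(G \in A, M >= t) = \int_(A `&` [0, 1]) exp (lambda (x - t)) dx,
   since t - x >= 0 for every x in [0, 1]. The dependence on t factors out, so
   that, conditionally on M >= m with m >= 1, G and M are independent, M - m is
   exponential and G has density proportional to exp (lambda x) on [0, 1]. The
   bound on alpha is P(M >= 1), hence it says exactly that m >= 1. The
   conditional expectation of G is 1 - 1 / lambda + 1 / (exp lambda - 1), whose
   last term is at most 2 / lambda ^ 2. *)
From HB Require Import structures.
Require Import Defs.
From mathcomp Require Import ring lra ftc.

Set Implicit Arguments.
Unset Strict Implicit.
Unset Printing Implicit Defensive.

Local Open Scope classical_set_scope.
Local Open Scope ring_scope.

(** * Joint law and expected product of two independent variables *)

Section independence.
Context d (T : measurableType d) (R : realType) (P : probability T R).
Variables X Y : {RV P >-> R}.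
Hypothesis indXY : independent_RV X Y.

Let pairXY w := (X w, Y w).

Let measurable_pairXY : measurable_fun setT pairXY.
Proof. exact: measurable_fun_pair. Qed.

#[local] HB.instance Definition _ :=
  isMeasurableFun.Build _ _ _ _ pairXY measurable_pairXY.

(** Independence makes the law of the pair agree with the product measure on rectangles, and the
    product measure is determined by these. *)
Lemma independent_joint_distribution S : measurable S ->
  P [set w | S (X w, Y w)] = (distribution P X \x distribution P Y)%E S.
Proof.
move=> mS.
by rewrite (@product_measure_unique _ _ _ _ _ _ _ (distribution P pairXY)).
Qed.

(** Both claims are transferred to the product of the marginal laws, where Tonelli gives the
    integrability of [x * y] and Fubini its integral. First moments suffice. *)
Lemma independent_expectation_prod :
  (X : T -> R) \in Lfun P 1 -> (Y : T -> R) \in Lfun P 1 ->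
  X \* Y \in Lfun P 1 /\ ('E_P[X \* Y] = 'E_P[X] * 'E_P[Y])%E.
Proof.
move=> /Lfun1_integrable iX /Lfun1_integrable iY.
pose h (z : R * R) : \bar R := (z.1 * z.2)%:E.
have mh : measurable_fun setT h.
  by apply/measurable_EFinP; apply: measurable_funM.
have mE : measurable_fun [set: R] (@EFin R).
  by apply/measurable_EFinP; exact: measurable_id.
have idX : (distribution P X).-integrable setT EFin.
  exact: integrable_pushforward.
have idY : (distribution P Y).-integrable setT EFin.
  exact: integrable_pushforward.
have joint S : measurable S -> S `<=` setT ->
  distribution P pairXY S = (distribution P X \x distribution P Y)%E S.
  by move=> mS _; rewrite -independent_joint_distribution.
have ih : (distribution P X \x distribution P Y)%E.-integrable setT h.
  apply/integrable12ltyP => //.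
  under eq_integral => x _.
    under eq_integral => y _ do rewrite /h /= normrM EFinM.
    rewrite ge0_integralZl//; [|exact: measurableT_comp..].
    over.
  rewrite ge0_integralZr//; first last.
  - exact: integral_ge0.
  - exact: measurableT_comp.
  move/integrableP : idX => [_ iX1]; move/integrableP : idY => [_ iY1].
  apply: lte_mul_pinfty => //; first exact: integral_ge0.
  by rewrite ge0_fin_numE//; exact: integral_ge0.
have ip : P.-integrable setT (h \o pairXY).
  apply/integrableP; split.
    exact: (measurableT_comp mh measurable_pairXY).
  rewrite -(@ge0_integral_distribution _ _ _ _ _ P pairXY (abse \o h))//;
    [|exact: (measurableT_comp _ mh)|by move=> z; exact: abse_ge0].
  rewrite (eq_measure_integral _ joint).
  by move/integrableP : ih => [].
split; first exact/Lfun1_integrable.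
rewrite !unlock.
rewrite -(@integral_distribution _ _ _ _ _ P pairXY h)//.
rewrite (eq_measure_integral _ joint) -integral12_prod_meas1//.
rewrite /fubini_F /h/=.
under eq_integral => x _.
  under eq_integral => y _ do rewrite EFinM.
  rewrite integralZl//.
  over.
have Yfin := integrable_fin_num measurableT idY.
rewrite -(fineK Yfin) integralZr// fineK//.
by rewrite !integral_distribution.
Qed.

End independence.

(** * Integrals of exponentials by the fundamental theorem of calculus *)

Section integrals.
Context (R : realType).
Implicit Types l a b t s x : R.
Notation mu := lebesgue_measure.

Lemma integral_derive_itv (F f : R -> R) a b : a <= b ->
  (forall x, is_derive x 1 F (f x)) -> continuous f ->
  (\int[mu]_(x in `[a, b]) (f x)%:E = (F b - F a)%:E)%E.
Proof.
move=> ab dF cf.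
(* The fundamental theorem is invoked for [a < b]; for [a = b] both sides are zero. *)
move: ab; rewrite le_eqVlt => /predU1P[<-|ab].
  by rewrite set_itv1 integral_set1 subrr.
have cF : continuous F.
  move=> x; apply: differentiable_continuous; apply/derivable1_diffP.
  by case: (dF x).
rewrite (@continuous_FTC2 _ f F a b ab) ?EFinB//.
- exact: continuous_subspaceT.
- split => [x _||]; first by case: (dF x).
  + exact/cvg_at_right_filter/cF.
  + exact/cvg_at_left_filter/cF.
- by move=> x _; rewrite derive1E; case: (dF x).
Qed.

Lemma is_derive_expRMl l t x :
  is_derive x 1 (fun y => expR (l * (y - t))) (l * expR (l * (x - t))).
Proof.
apply: is_derive_eq.
rewrite /GRing.scale/=; ring.
Qed.

Lemma continuous_expRMl l t : continuous (fun y => expR (l * (y - t))).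
Proof.
move=> x; apply: differentiable_continuous; apply/derivable1_diffP.
by case: (is_derive_expRMl l t x).
Qed.

Lemma integral_expRMl l t a b : l != 0 -> a <= b ->
  (\int[mu]_(x in `[a, b]) (expR (l * (x - t)))%:E
   = ((expR (l * (b - t)) - expR (l * (a - t))) / l)%:E)%E.
Proof.
move=> l0 ab.
have dF x :
    is_derive x 1 (fun y => expR (l * (y - t)) / l) (expR (l * (x - t))).
  have ? := is_derive_expRMl l t x.
  by apply: is_derive_eq; rewrite /GRing.scale/=; field.
by rewrite (integral_derive_itv ab dF (@continuous_expRMl l t)) mulrBl.
Qed.

Lemma exponential_prob_itvcy l s : 0 < l -> 0 <= s ->
  exponential_prob l `[s, +oo[ = (expR (- l * s))%:E.
Proof.
move=> l0 s0.
rewrite /exponential_prob.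
(* The dummy shift [x - 0] matches the form of [is_derive_expRMl]. Since [0 <= s <= x], the density
   is on its exponential branch. *)
transitivity (\int[mu]_(x in `[s, +oo[) (l * expR (- l * (x - 0)))%:E)%E.
  apply: eq_integral => x; rewrite inE/= in_itv/= andbT => sx.
  by rewrite exponential_pdfE ?(le_trans s0)// subr0.
have dF x : is_derive x 1 (fun y => - expR (- l * (y - 0)))
    (l * expR (- l * (x - 0))).
  have ? := is_derive_expRMl (- l) 0 x.
  by apply: is_derive_eq; rewrite mulNr opprK.
have cF : continuous (fun y : R => - expR (- l * (y - 0))).
  move=> x; apply: differentiable_continuous; apply/derivable1_diffP.
  by case: (dF x).
rewrite (@ge0_continuous_FTC2y _ _ (fun y => - expR (- l * (y - 0))) s 0).
- by rewrite subr0 EFinN oppeK add0e.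
- by move=> x _; rewrite mulr_ge0 ?expR_ge0// ltW.
- apply: continuous_subspaceT => x; apply: cvgM; first exact: cvg_cst.
  exact: continuous_expRMl.
- rewrite -[X in _ --> X]oppr0; apply: cvgN.
  rewrite (_ : (fun x => expR (- l * (x - 0)))
      = (fun z => expR (- z)) \o (fun z => l * z)); last first.
    by apply/funext => x /=; rewrite subr0 mulNr.
  apply: (@cvg_comp _ _ _ _ _ _ (pinfty_nbhs R)); last exact: cvgr_expR.
  exact: gt0_cvgMry.
- by move=> x _; case: (dF x).
- exact/cvg_at_right_filter/cF.
- by move=> x _; rewrite derive1E; case: (dF x).
Qed.

End integrals.

(** * Change of display for the Borel sets of the line *)

Section borel_display.
Context (R : realType).

Let idR : measurableTypeR R -> R := idfun.

#[local] HB.instance Definition _ :=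
  @isMeasurableFun.Build _ _ (measurableTypeR R) R idR
    (@measurable_id _ _ setT).

(* [R] and [measurableTypeR R] carry the same sigma-algebra under two different
   displays, so that a measure on one is not a measure on the other. *)
Lemma ge0_integral_measurableTypeR (m1 : {measure set R -> \bar R})
    (m2 : {measure set (measurableTypeR R) -> \bar R}) (f : R -> \bar R) :
  (forall A : set R, measurable A -> m1 A = m2 A) ->
  measurable_fun [set: R] f -> (forall x, 0 <= f x)%E ->
  (\int[m1]_x f x = \int[m2]_x f x)%E.
Proof.
move=> m12 mf f0.
rewrite (@eq_measure_integral _ _ _ _ (pushforward m2 idR) m1).
  by rewrite ge0_integral_pushforward.
by move=> A mA _; exact: m12.
Qed.

End borel_display.

(** * Conditional probability given the top event *)

Section top_prob.
Context d (T : measurableType d) (R : realType) (P : probability T R).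
Variables (M : {RV P >-> R}) (alpha m : R).
Hypotheses (alpha0 : 0 < alpha) (quant : is_top_quantile M alpha m).

(** The fallback of [mnormalize] concerns total mass 0 or [+oo]; here the mass is [alpha], positive
    and finite. *)
Lemma top_probE A :
  top_prob M m A = (P (A `&` top_event M m) * (alpha^-1)%:E)%E.
Proof.
have eT : mrestr P (measurable_top_event M m) [set: T] = alpha%:E.
  by rewrite /mrestr/= setTI.
rewrite /top_prob/= /mnormalize; case: ifPn => [/orP[]/eqP H|_].
- by have /eqP := etrans (esym eT) H; rewrite eqe gt_eqF.
- by have := etrans (esym eT) H.
- by congr (_ * (_^-1)%:E)%E; exact: (congr1 fine eT).
Qed.

End top_prob.

(** * Tails of the measure before conditioning, and location of the quantile *)

Section model.
Context d (T : measurableType d) (R : realType) (P : probability T R).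
Variables (G xi : {RV P >-> R}) (l : R).
Hypothesis l0 : 0 < l.
Hypothesis lawG : forall A, measurable A ->
  distribution P G A = uniform_prob (@ltr01 R) A.
Hypothesis lawxi : forall A, measurable A ->
  distribution P xi A = exponential_prob l A.
Hypothesis indG : independent_RV G xi.
Notation mu := lebesgue_measure.

Lemma joint_tail A t : measurable A -> 1 <= t ->
  P [set w | A (G w) /\ t <= noisy G xi w]
  = (\int[mu]_(x in A `&` `[0%R, 1%R]) (expR (l * (x - t)))%:E)%E.
Proof.
move=> mA t1.
pose S := [set z : R * R | A z.1 /\ t <= z.1 + z.2].
have mS : measurable S.
  rewrite (_ : S = (A `*` setT)
      `&` (fun z : R * R => z.1 + z.2) @^-1` `[t, +oo[); last first.
    by apply/seteqP; split => z /=; rewrite in_itv/= andbT => -[] // [].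
  apply: measurableI; first exact: measurableX.
  rewrite -[X in measurable X]setTI.
  by apply: (@measurable_funD _ _ R setT fst snd).
transitivity (P [set w | S (G w, xi w)]); first by [].
rewrite (independent_joint_distribution indG mS) /product_measure1.
(* The law of [G] is replaced by [uniform_prob], which lives on the other display of the Borel
   sets. *)
transitivity
  (\int[uniform_prob (@ltr01 R)]_x distribution P xi (xsection S x))%E.
  apply: ge0_integral_measurableTypeR => //.
  exact: measurable_fun_xsection.
rewrite integral_uniform//=; last first.
  exact: measurable_fun_xsection.
rewrite subr0 invr1 mul1e integral_mkcondl.
apply: eq_integral => x; rewrite inE/= in_itv/= => /andP[x0 x1].
rewrite /= patchE.
have -> : xsection S x = if x \in A then `[t - x, +oo[%classic else set0.
  apply/seteqP; split => y; rewrite /xsection/= inE /S/=.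
    by move=> [Ax txy]; rewrite mem_set//= in_itv/= andbT lerBlDl.
  by case: ifPn => //; rewrite inE /= in_itv/= andbT lerBlDl.
case: ifPn => xA; last by rewrite measure0.
rewrite lawxi// exponential_prob_itvcy// ?subr_ge0 ?(le_trans x1)//.
by congr (expR _)%:E; ring.
Qed.

Lemma noisy_tail t : 1 <= t ->
  P (top_event (noisy G xi) t) = (expR (- l * t) * (expR l - 1) / l)%:E.
Proof.
move=> t1.
rewrite (_ : top_event _ _
    = [set w | setT (G w) /\ t <= noisy G xi w]); last first.
  by apply/seteqP; split => w /=; [split|case].
rewrite joint_tail// setTI integral_expRMl ?gt_eqF//.
congr ((_ / _)%:E).
rewrite [RHS]mulrBr [in RHS]mulr1 -expRD; congr (expR _ - expR _); ring.
Qed.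

(** The formula of [noisy_tail] starts at 1, so thresholds below 1 need a separate argument: an
    event [E] of positive probability lies in the larger top event and misses the smaller one. *)
Lemma noisy_tail_lt t : t < 1 ->
  (P (top_event (noisy G xi) 1) < P (top_event (noisy G xi) t))%E.
Proof.
move=> t1.
(* Truncating at 0 keeps the interval chosen for [G] inside its support. *)
pose s := Num.max t 0.
have s1 : s < 1 by rewrite gt_max t1 ltr01.
have s0 : 0 <= s by rewrite le_max lexx orbT.
have ts : t <= s by rewrite le_max lexx.
clearbody s.
(* With one third of the gap, [G + xi <= s + 2 * h < 1] on [E]. *)
pose h := (1 - s) / 3.
have h0 : 0 < h by rewrite /h; lra.
pose E := G @^-1` `[s, s + h] `&` xi @^-1` `[0, h].
have mE : measurable E by apply: measurableI; exact: measurable_funPTI.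
have PE : (0 < P E)%E.
  rewrite indG//; apply: mule_gt0.
    rewrite [X in (_ < X)%E](lawG (measurable_itv _)) /uniform_prob.
    rewrite integral_uniform_pdf.
    rewrite setIidl; last by apply: subset_itv; rewrite bnd_simp /h; lra.
    rewrite (eq_integral (cst 1%E)); last first.
      move=> x; rewrite inE/= in_itv/= => /andP[sx xh].
      rewrite /uniform_pdf ifT; first by rewrite subr0 invr1.
      by rewrite (le_trans s0 sx)/= (le_trans xh)// /h; lra.
    rewrite integral_cst//= mul1e lebesgue_measure_itv/= lte_fin.
    rewrite ifT; last by lra.
    by rewrite -EFinD lte_fin; lra.
  rewrite [X in (_ < X)%E](lawxi (measurable_itv _)) exponential_prob_itv0c//.
  by rewrite -EFinB lte_fin subr_gt0 expR_lt1 mulNr oppr_lt0 mulr_gt0.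
have mT u : measurable (top_event (noisy G xi) u).
  exact: measurable_top_event.
have dis : top_event (noisy G xi) 1 `&` E = set0.
  apply/seteqP; split => // w [] /=; rewrite /top_event /E/=.
  rewrite !in_itv/= => Mw [/andP[_ Gw] /andP[_ xw]].
  have : G w + xi w <= s + h + h by rewrite lerD.
  by apply/negP; rewrite -ltNge (lt_le_trans _ Mw)// /h; lra.
apply: (@lt_le_trans _ _ (P (top_event (noisy G xi) 1 `|` E))).
  by rewrite measureU// lteDl// fin_num_measure.
apply: le_measure; rewrite ?inE//; first exact: measurableU.
move=> w [|[]]; rewrite /top_event/= ?in_itv/=.
  by apply: le_trans; exact: ltW.
move=> /andP[sG _] /andP[x0 _].
by rewrite (le_trans ts)// -[s]addr0 lerD.
Qed.

(** A threshold below 1 would have a tail strictly above that of 1, which equals the bound on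
    [alpha]. *)
Lemma quantile_ge1 alpha m : alpha <= l^-1 * (1 - expR (- l)) ->
  is_top_quantile (noisy G xi) alpha m -> 1 <= m.
Proof.
move=> la q; rewrite leNgt; apply/negP => /noisy_tail_lt.
rewrite q noisy_tail// lte_fin ltNge => /negP; apply.
rewrite (le_trans la)// mulrC mulr1.
have -> : expR (- l) * (expR l - 1) = 1 - expR (- l); last exact: lexx.
by rewrite mulrBr mulr1 -expRD addNr expR0.
Qed.

End model.

(** * Integrability from an exponential tail bound *)

Section exponential_tail_integrable.
Context d (T : measurableType d) (R : realType) (P : probability T R).
Variables (X : {RV P >-> R}) (l c : R).
Hypothesis l0 : 0 < l.

Let absX w : R := `|X w|.

Let measurable_absX : measurable_fun setT absX.
Proof. exact: measurableT_comp. Qed.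

#[local] HB.instance Definition _ :=
  isMeasurableFun.Build _ _ _ _ absX measurable_absX.

(** The mean of [absX] is the integral of its tail over [r >= 0], here dominated by a multiple of
    the exponential density. The shift [c] will be [m] for the measure and 1 for the goal. *)
Lemma exponential_tail_Lfun1 :
  (forall r : R, 0 <= r -> (
    P [set w | (r < `|X w|)%R] <= (expR (l * c) * expR (- l * r))%:E)%E) ->
  (X : T -> R) \in Lfun P 1.
Proof.
move=> tailX; apply/Lfun1_integrable/integrableP; split.
  exact/measurable_EFinP.
have := @ge0_expectation_ccdf _ _ _ P absX (fun x => normr_ge0 _).
rewrite expectation_def/= => ->.
apply: (@le_lt_trans _ _ (\int[lebesgue_measure]_(r in `[0%R, +oo[)
    ((expR (l * c) / l)%:E * (exponential_pdf l r)%:E))%E).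
  apply: ge0_le_integral => //.
  - exact: measurable_funTS (ccdf_measurable _).
  - apply: measurable_funTS; apply: measurable_funeM.
    by apply/measurable_EFinP; exact: measurable_exponential_pdf.
  - move=> r; rewrite /= in_itv/= andbT => r0.
    rewrite (_ : ccdf _ r = P [set w | (r < `|X w|)%R]); last first.
      congr (P _); apply/seteqP.
      by split => w; rewrite /= in_itv/= andbT.
    rewrite (le_trans (tailX r r0))// exponential_pdfE// -EFinM lee_fin.
    by rewrite mulrA divfK ?gt_eqF.
rewrite ge0_integralZl//=.
- by rewrite -/(exponential_prob l _) exponential_prob_itvcy// -EFinM ltry.
- apply: measurable_funTS; apply/measurable_EFinP.
  exact: measurable_exponential_pdf.
- by move=> r _; rewrite lee_fin exponential_pdf_ge0// ltW.
- by rewrite lee_fin divr_ge0 ?expR_ge0// ltW.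
Qed.

End exponential_tail_integrable.

(** * The conditional law: independence, covariance and expectation of the goal *)

Section conditional.
Context d (T : measurableType d) (R : realType) (P : probability T R).
Variables (G xi : {RV P >-> R}) (l alpha m : R).
Hypothesis l0 : 0 < l.
Hypothesis lawG : forall A, measurable A ->
  distribution P G A = uniform_prob (@ltr01 R) A.
Hypothesis lawxi : forall A, measurable A ->
  distribution P xi A = exponential_prob l A.
Hypothesis indG : independent_RV G xi.
Hypothesis alpha0 : 0 < alpha.
Hypothesis m1 : 1 <= m.
Hypothesis quant : is_top_quantile (noisy G xi) alpha m.
Notation mu := lebesgue_measure.
Notation M := (noisy G xi).
Notation Q := (top_prob M m).

Let alphaE : alpha = expR (- l * m) * (expR l - 1) / l.
Proof.
have := quant.
by rewrite /is_top_quantile (noisy_tail l0 lawG lawxi indG m1) => -[].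
Qed.

Lemma top_prob_setI A : Q (A `&` top_event M m) = Q A.
Proof. by rewrite !(top_probE alpha0 quant) -setIA setIid. Qed.

Lemma top_prob_preimage A : measurable A ->
  Q (G @^-1` A) = (\int[mu]_(x in A `&` `[0%R, 1%R]) (expR (l * (x - m)))%:E
                   * (alpha^-1)%:E)%E.
Proof.
move=> mA; rewrite (top_probE alpha0 quant).
by rewrite -(joint_tail l0 lawG lawxi indG mA m1).
Qed.

(** Raising the threshold from [m] to [t] multiplies the integrand of [joint_tail] by a constant
    that depends neither on [x] nor on [A]. *)
Lemma memoryless A t : measurable A -> m <= t ->
  Q (G @^-1` A `&` top_event M t)
  = ((expR (- l * (t - m)))%:E * Q (G @^-1` A))%E.
Proof.
move=> mA mt; rewrite top_prob_preimage// (top_probE alpha0 quant).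
rewrite (_ : G @^-1` A `&` top_event M t `&` top_event M m
    = [set w | A (G w) /\ t <= M w]); last first.
  apply/seteqP; split => w; rewrite /top_event/=; first by case=> -[].
  by case=> Aw tw; do !split => //; exact: le_trans tw.
rewrite (joint_tail l0 lawG lawxi indG mA (le_trans m1 mt)) muleA.
congr (_ * _)%E.
rewrite -ge0_integralZl//=.
- by apply: eq_integral => x _; rewrite -EFinM -expRD; congr (expR _)%:E; ring.
- exact: measurableI.
- apply: measurable_funTS; apply/measurable_EFinP.
  apply: continuous_measurable_fun.
  exact: continuous_expRMl.
Qed.

(** This is [memoryless] with [A] the whole line; the maximum accounts for [t < m], where the
    conditional probability is 1. *)
Lemma top_prob_tail t : Q (top_event M t) = (expR (- l * (Num.max t m - m)))%:E.
Proof.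
have [mt|/ltW tm] := leP m t.
  rewrite -[X in Q X]setTI -(preimage_setT G) memoryless//.
  by rewrite preimage_setT probability_setT mule1.
rewrite subrr mulr0 expR0 -top_prob_setI setIidr.
  by rewrite -(setTI (top_event _ _)) top_prob_setI probability_setT.
by move=> w; exact: le_trans.
Qed.

(** For fixed [A], both sides are finite measures in [B], called [n1] and [n2]. By [memoryless] they
    agree on closed upper rays, which generate the Borel sets. *)
Lemma independent_top_prob : @independent_RV _ _ _ Q G M.
Proof.
move=> A B mA mB.
have mGA : measurable (G @^-1` A) by exact: measurable_funPTI.
have QGA : Q (G @^-1` A) \is a fin_num by exact: fin_num_measure.
pose c := NngNum (fine_ge0 (measure_ge0 Q (G @^-1` A))).
have mM : measurable_fun setT M by exact: measurable_funP.
pose pM : {measure set R -> \bar R} :=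
  pushforward (mrestr Q mGA) M.
pose n1 := pM mM.
pose n2 : {measure set R -> \bar R} := mscale c (distribution Q M).
have n1E S : n1 S = Q (G @^-1` A `&` M @^-1` S) by rewrite setIC.
have n2E S : n2 S = (Q (G @^-1` A) * Q (M @^-1` S))%E.
  by transitivity ((fine (Q (G @^-1` A)))%:E * Q (M @^-1` S))%E;
    [|rewrite fineK].
rewrite -n1E -n2E.
have borelE : @measurable _ R = <<s @RGenCInfty.G R >>.
  exact: RGenCInfty.measurableE.
(* The rays are stable under intersection, and those starting at [- k] exhaust the line with finite
   mass. *)
apply: (@measure_unique _ R R (@RGenCInfty.G R)
  (fun k => `[- k%:R, +oo[%classic) borelE _ _ _ n1 n2 _ _ B mB).
- move=> _ _ [x ->] [y ->]; exists (Num.max x y).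
  by apply/seteqP; split => z /=; rewrite !in_itv/= !andbT ge_max => /andP.
- by move=> k; eexists.
- apply/seteqP; split => // x _; exists (Num.truncn `|x|).+1 => //=.
  rewrite in_itv/= andbT lerNl (le_trans (ler_norm _))// normrN ltW//.
  exact: truncnS_gt.
- move=> _ [t ->].
  rewrite n1E n2E.
  have -> : M @^-1` `[t, +oo[ = top_event M t.
    by apply/seteqP; split => w /=; rewrite in_itv/= andbT.
  rewrite top_prob_tail.
  (* For [t < m] the ray has conditional probability 1 and both sides reduce to the probability of
     the event on [G]. *)
  have [mt|/ltW tm] := leP m t; first by rewrite memoryless// muleC.
  rewrite subrr mulr0 expR0 mule1 -[LHS]top_prob_setI -setIA.
  rewrite (@setIidr _ (top_event M t)) ?top_prob_setI//.
  by move=> w; exact: le_trans.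
- move=> k; rewrite n1E -ge0_fin_numE//; apply: fin_num_measure.
  by apply: measurableI => //; exact: measurable_funPTI.
Qed.

Lemma Lfun1_noisy : (M : T -> R) \in Lfun Q 1.
Proof.
apply: (@exponential_tail_Lfun1 _ _ _ Q M l m l0) => r r0.
(* On the conditioning event [M >= m >= 1], so the absolute value of [M] is [M] itself. *)
rewrite -top_prob_setI (@le_trans _ _ (Q (top_event M r)))//.
  apply: le_measure; rewrite ?inE//.
  - apply: measurableI; last exact: measurable_top_event.
    rewrite (_ : [set w | _] = (fun w => `|M w|) @^-1` `]r, +oo[); last first.
      by apply/seteqP; split => w; rewrite /= in_itv/= andbT.
    rewrite -[X in measurable X]setTI.
    by apply: (measurableT_comp (@normr_measurable R setT) (measurable_funP M)).
  - exact: measurable_top_event.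
  - move=> w [/= rw]; rewrite /top_event/= => mw.
    rewrite ger0_norm in rw; first exact: ltW.
    by rewrite (le_trans _ mw)// (le_trans ler01).
rewrite top_prob_tail lee_fin -expRD ler_expR.
have : r <= Num.max r m by rewrite le_max lexx.
by move=> /(ler_wpM2l (ltW l0)); lra.
Qed.

(** Conditionally, [G] still lies in [[0, 1]] almost surely: the tail vanishes for [r >= 1], and for
    [r <= 1] the bound with [c = 1] is at least 1. *)
Lemma Lfun1_goal : (G : T -> R) \in Lfun Q 1.
Proof.
have mabs r : measurable [set x : R | r < `|x|].
  rewrite (_ : [set x | _] = (@Num.norm _ R) @^-1` `]r, +oo[); last first.
    by apply/seteqP; split => x; rewrite /= in_itv/= andbT.
  by rewrite -[X in measurable X]setTI; exact: normr_measurable.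
apply: (@exponential_tail_Lfun1 _ _ _ Q G l 1 l0) => r r0.
have [r1|/ltW r1] := leP 1 r.
  rewrite (_ : [set w | _] = G @^-1` [set x | r < `|x|])//.
  rewrite top_prob_preimage// (_ : _ `&` _ = set0).
    by rewrite integral_set0 mul0e lee_fin mulr_ge0 ?expR_ge0.
  apply/seteqP; split => // x [] /=; rewrite in_itv/= => rx /andP[x0 x1].
  by move: rx; rewrite ger0_norm// ltNge (le_trans x1 r1).
rewrite (@le_trans _ _ 1%E)//; first apply: probability_le1.
  by rewrite -[X in measurable X]setTI; exact: (measurable_funP G _ _ (mabs r)).
rewrite lee_fin -expRD -[leLHS]expR0 ler_expR.
by move: r1 => /(ler_wpM2l (ltW l0)); lra.
Qed.

Lemma top_covariance0 : covariance Q G M = 0%E.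
Proof.
have [L EGM] :=
  independent_expectation_prod independent_top_prob Lfun1_goal Lfun1_noisy.
rewrite covarianceE ?Lfun1_goal ?Lfun1_noisy//.
by rewrite EGM subee// fin_numM// expectation_fin_num ?Lfun1_goal ?Lfun1_noisy.
Qed.

Let el1 : 0 < expR l - 1.
Proof. by rewrite subr_gt0 expR_gt1. Qed.

(** The factor [expR (- l * m)] occurs both in the integral and in [alpha], hence cancels: the law
    of [G] given the top event does not depend on [m]. *)
Lemma top_ccdf r : 0 <= r <= 1 ->
  ccdf (G : {RV Q >-> R}) r = ((expR l - expR (l * r)) / (expR l - 1))%:E.
Proof.
move=> /andP[r0 r1].
rewrite /ccdf [LHS]top_prob_preimage//.
rewrite (_ : _ `&` _ = `]r, 1%R]%classic); last first.
  apply/seteqP; split => x /=; rewrite !in_itv/= ?andbT.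
    by move=> [-> /andP[_ ->]].
  by move=> /andP[rx ->]; rewrite rx (le_trans r0 (ltW rx)).
rewrite integral_itv_obnd_cbnd; last first.
  apply: measurable_funTS; apply/measurable_EFinP.
  apply: continuous_measurable_fun.
  exact: continuous_expRMl.
rewrite integral_expRMl ?gt_eqF// -EFinM alphaE; congr (_%:E).
have E x : expR (l * (x - m)) = expR (l * x) * expR (- l * m).
  by rewrite -expRD; congr expR; ring.
rewrite !E mulr1; field.
by rewrite !gt_eqF ?expR_gt0.
Qed.

Lemma top_ccdf0 r : 1 <= r -> ccdf (G : {RV Q >-> R}) r = 0%E.
Proof.
move=> r1; rewrite /ccdf [LHS]top_prob_preimage//.
rewrite (_ : _ `&` _ = set0) ?integral_set0 ?mul0e//.
apply/seteqP; split => // x [] /=; rewrite !in_itv/= andbT => rx /andP[_].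
by rewrite leNgt (le_lt_trans r1 rx).
Qed.

Lemma top_cdf0 r : r < 0 -> cdf (G : {RV Q >-> R}) r = 0%E.
Proof.
move=> r0; rewrite /cdf [LHS]top_prob_preimage//.
rewrite (_ : _ `&` _ = set0) ?integral_set0 ?mul0e//.
apply/seteqP; split => // x [] /=; rewrite !in_itv/= => xr /andP[x0 _].
by have := le_lt_trans (le_trans x0 xr) r0; rewrite ltxx.
Qed.

(** The expectation is the integral of the upper tail over [r >= 0] minus that of the lower tail
    over [r < 0]. The latter is 0, and the former lives on [[0, 1]], where [F] is a primitive. *)
Lemma top_expectation :
  'E_Q[G]%E = (1 / l * ((l * expR l - expR l + 1) / (expR l - 1)))%:E.
Proof.
rewrite (@expectation_cdf_ccdf _ _ _ Q G); last exact: Lfun1_goal.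
rewrite [X in (_ - X)%E](eq_integral (cst 0%E)); last first.
  by move=> r; rewrite inE/= in_itv/= => r0; exact: top_cdf0.
rewrite integral0 sube0.
pose f r := (expR l - expR (l * (r - 0))) / (expR l - 1).
transitivity (\int[mu]_(r in `[0%R, +oo[) ((EFin \o f) \_ `[0%R, 1%R]) r)%E.
  apply: eq_integral => r; rewrite inE/= in_itv/= andbT => r0.
  rewrite patchE; case: ifPn; rewrite ?inE ?notin_setE/= in_itv/= r0/=.
    by move=> r1; rewrite /f subr0; apply: top_ccdf; rewrite r0.
  by move=> /negP; rewrite -ltNge => /ltW r1; exact: top_ccdf0.
rewrite -integral_mkcondr setIidr; last by apply: subset_itvl; rewrite bnd_simp.
pose F r := (r * expR l - expR (l * (r - 0)) / l) / (expR l - 1).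
have dF (x : R) : is_derive x 1 F (f x).
  have ? := is_derive_expRMl l 0 x.
  apply: is_derive_eq.
  rewrite /GRing.scale/= /f; field.
  by rewrite !gt_eqF.
have cf : continuous f.
  move=> x; apply: cvgM; last exact: cvg_cst.
  apply: cvgB; first exact: cvg_cst.
  exact: continuous_expRMl.
rewrite (integral_derive_itv ler01 dF cf) /F !subr0 mul0r mulr0 expR0 mulr1.
congr (_%:E); field.
by rewrite !gt_eqF.
Qed.

End conditional.

(** * Error estimate for small noise, and conclusion *)

Lemma top_expectation_error (R : realType) (l : R) : 0 < l ->
  `|1 / l * ((l * expR l - expR l + 1) / (expR l - 1)) - (1 - l^-1)|
  <= 2 * l^-1 ^+ 2.
Proof.
move=> l0.
(* Only the constant and quadratic terms of the exponential series are kept. *)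
have el : l ^+ 2 / 2 <= expR l - 1.
  by have := expR_ge1Dxn 1 (ltW l0); rewrite (_ : 2`! = 2)%N// => h; lra.
have l2 : 0 < l ^+ 2 / 2 by rewrite divr_gt0// exprn_gt0.
have el1 := lt_le_trans l2 el.
have -> : 1 / l * ((l * expR l - expR l + 1) / (expR l - 1)) - (1 - l^-1)
          = (expR l - 1)^-1.
  by field; rewrite !gt_eqF.
rewrite ger0_norm; last by rewrite invr_ge0 ltW.
have -> : 2 * l^-1 ^+ 2 = (l ^+ 2 / 2)^-1 by field; rewrite gt_eqF.
by rewrite lef_pV2 ?posrE.
Qed.

Lemma exp_rate_gt0 (R : realType) (eps : R) : 0 < eps -> 0 < exp_rate eps.
Proof. by move=> e0; rewrite invr_gt0 mulr_gt0// sqrtr_gt0. Qed.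

Lemma uniform_exponential_top (R : realType) (eps : R) d (T : measurableType d)
    (P : probability T R) (G xi : {RV P >-> R}) (alpha m : R) :
  0 < eps ->
  uniform_exponential_model G xi eps ->
  0 < alpha <= alpha_max eps ->
  is_top_quantile (noisy G xi) alpha m ->
  let lambda := exp_rate eps in
  top_correlation G (noisy G xi) m = 0 /\
  'E_(top_prob (noisy G xi) m)[G]%E =
    (1 / lambda *
     ((lambda * expR lambda - expR lambda + 1) / (expR lambda - 1)))%:E.
Proof.
move=> e0 [lawG lawxi ind] /andP[a0 a1] quant /=.
have l0 := exp_rate_gt0 e0.
have m1 : 1 <= m.
  apply: (quantile_ge1 l0 lawG lawxi ind _ quant).
  by rewrite /exp_rate invrK.
split; last exact: (top_expectation l0 lawG lawxi ind a0 m1 quant).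
have cov0 := top_covariance0 l0 lawG lawxi ind a0 m1 quant.
(* The numerator is 0, so the quotient is 0 whatever the conditional variances are. *)
by rewrite /top_correlation cov0 mul0r.
Qed.

Theorem theorem1 (R : realType) :
  (forall (eps : R) (d : measure_display) (T : measurableType d)
      (P : probability T R) (G xi : {RV P >-> R}) (alpha m : R),
    0 < eps ->
    uniform_exponential_model G xi eps ->
    0 < alpha <= alpha_max eps ->
    is_top_quantile (noisy G xi) alpha m ->
    let lambda := exp_rate eps in
    top_correlation G (noisy G xi) m = 0 /\
    'E_(top_prob (noisy G xi) m)[G]%E =
      (1 / lambda *
       ((lambda * expR lambda - expR lambda + 1) / (expR lambda - 1)))%:E)
  /\
  (forall (d : R -> measure_display) (T : forall eps, measurableType (d eps))
      (P : forall eps, probability (T eps) R)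
      (G xi : forall eps, {RV (P eps) >-> R}) (alpha m : R -> R),
    (forall eps, 0 < eps ->
      [/\ uniform_exponential_model (G eps) (xi eps) eps,
          0 < alpha eps <= alpha_max eps &
          is_top_quantile (noisy (G eps) (xi eps))
            (alpha eps) (m eps)]) ->
    (fun eps : R => fine
      'E_(top_prob (noisy (G eps) (xi eps)) (m eps))[G eps]%E : R^o)
    = (fun eps : R => 1 - eps * Num.sqrt 12 : R^o)
      +O_ (0^'+) (fun eps : R => eps ^+ 2 : R^o)).
Proof.
split; first exact: uniform_exponential_top.
move=> d T P G xi alpha m model.
apply/eqaddOP.
near=> k.
near=> eps.
have e0 : 0 < eps by near: eps; exact: nbhs_right_gt.
have [mod_eps a_eps q_eps] := model eps e0.
have [_ EG] := uniform_exponential_top e0 mod_eps a_eps q_eps.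
have -> : ((fun eps : R => fine
      'E_(top_prob (noisy (G eps) (xi eps)) (m eps))[G eps]%E : R^o)
    - (fun eps : R => 1 - eps * Num.sqrt 12 : R^o)) eps =
  1 / exp_rate eps * ((exp_rate eps * expR (exp_rate eps)
    - expR (exp_rate eps) + 1) / (expR (exp_rate eps) - 1))
    - (1 - (exp_rate eps)^-1).
  by rewrite !fctE EG/= /exp_rate invrK.
have err := top_expectation_error (exp_rate_gt0 e0).
(* Since the inverse rate is [eps * Num.sqrt 12], the error bound is [24 * eps ^+ 2]; any [k >= 24]
   serves, and [k] is taken near [+oo]. *)
have k_eps : 2 * (exp_rate eps)^-1 ^+ 2 <= k * `|eps ^+ 2|.
  rewrite /exp_rate invrK exprMn sqr_sqrtr// normrX gtr0_norm//.
  have -> : 2 * (eps ^+ 2 * 12) = 24 * eps ^+ 2 by ring.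
  by rewrite ler_wpM2r ?sqr_ge0.
exact: (le_trans err k_eps).
Unshelve. all: by end_near. Qed.
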